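(* Let $m_0\ge 1$ and $r\ge 1$ be integers, let $B_1,\dots,B_{m_0+1}$ be the $r\times r$ real matrices describing the factor loadings in the $m_0+1$ regimes, and let $j\in\{1,\dots,m_0\}$. Put $r_j=\mathrm{rank}(B_j)$, $r_{j+1}=\mathrm{rank}(B_{j+1})$ and $r_{j,j+1}=\mathrm{rank}([B_j,B_{j+1}])$. Then there exists a nonsingular $r\times r$ matrix $\mathbf{R}$ such that $B_j\mathbf{R}=B_{j+1}$ if and only if $r_{j,j+1}=\min(r_j,r_{j+1})$.
   Context: Setting: a factor model with $m_0$ breaks, in which regime $j$ ($j=1,\dots,m_0+1$) has $N\times r$ loading matrix $\Lambda_j=\Lambda B_j$, where $\Lambda$ is an $N\times r$ matrix of full column rank and $B_j$ is $r\times r$ (possibly singular). $[B_j,B_{j+1}]$ denotes the $r\times 2r$ matrix obtained by horizontal concatenation. $r_j$ is called the number of effective factors in regime $j$, and $r_{j,j+1}$ the number of pseudo-factors in the combined regimes $j$ and $j+1$. *)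

(* Defs.v *)
From HB Require Import structures.
From mathcomp Require Import all_boot all_order all_algebra.
From mathcomp Require Import reals.
Set Implicit Arguments. Unset Strict Implicit. Unset Printing Implicit Defensive.

Local Open Scope ring_scope.

(* The regimes 1, ..., m0 + 1 are indexed by 'I_m0.+1 and the breaks
   1, ..., m0 by 'I_m0 (both shifted down by one): break j separates the
   regimes [regime_before j] and [regime_after j], of values j and j.+1. *)
Definition regime_before (m0 : nat) (j : 'I_m0) : 'I_m0.+1 :=
  widen_ord (leqnSn m0) j.

Definition regime_after (m0 : nat) (j : 'I_m0) : 'I_m0.+1 := lift ord0 j.

Definition effective_factors (R : realType) (m0 r : nat)
    (B : 'I_m0.+1 -> 'M[R]_r) (k : 'I_m0.+1) : nat :=
  \rank (B k).

Definition pseudo_factors (R : realType) (m0 r : nat)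
    (B : 'I_m0.+1 -> 'M[R]_r) (j : 'I_m0) : nat :=
  \rank (row_mx (B (regime_before j)) (B (regime_after j))).

(* Main.v *)
(* [B_j, B_{j+1}] has rank at least max(r_j, r_{j+1}), so the rank condition
   says exactly that B_j and B_{j+1} have the same column space, i.e. that they
   are right-equivalent. Row spaces of transposes play the role of column
   spaces below. *)
Require Import Defs.
From mathcomp Require Import all_boot all_order all_algebra.
From mathcomp Require Import reals.

Local Open Scope ring_scope.

(** Square matrices of equal shape share a row space iff a unit left factor links them; transposing
    moves that factor to the right. *)
Lemma right_equiv_eqmx_tr (F : fieldType) (m n : nat) (A B : 'M[F]_(m, n)) :
  (exists2 Q : 'M[F]_n, Q \in unitmx & A *m Q = B) <-> (A^T == B^T)%MS.
Proof.
split=> [[Q uQ <-] | /eqmxP/eqmx_sym/eqmxP/eqmxMunitP[P uP defB]].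
  apply/eqmxP/eqmx_sym/eqmxP/eqmxMunitP.
  by exists Q^T; rewrite ?unitmx_tr // trmx_mul.
exists P^T; first by rewrite unitmx_tr.
by apply: trmx_inj; rewrite trmx_mul trmxK.
Qed.

Lemma rank_addsmx_eq_minn (F : fieldType) (m1 m2 n : nat)
    (A : 'M[F]_(m1, n)) (B : 'M[F]_(m2, n)) :
  \rank (A + B)%MS = minn (\rank A) (\rank B) <-> (A == B)%MS.
Proof.
split=> [rAB | /eqmxP eqAB]; last first.
  have /eqmx_rank -> : (A + B == A)%MS.
    by rewrite addsmxSl andbT addsmx_sub submx_refl eqAB submx_refl.
  by rewrite eqAB minnn.
have leA : (\rank (A + B)%MS <= \rank A)%N by rewrite rAB geq_minl.
have leB : (\rank (A + B)%MS <= \rank B)%N by rewrite rAB geq_minr.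
(* As [A] lies in [A + B], the rank bound forces [A + B] into [A]; likewise for [B]. *)
rewrite (geq_leqif (mxrank_leqif_sup (addsmxSl A B))) in leA.
rewrite (geq_leqif (mxrank_leqif_sup (addsmxSr A B))) in leB.
by rewrite (submx_trans (addsmxSl A B) leB) (submx_trans (addsmxSr A B) leA).
Qed.

Theorem proposition1 (R : realType) (m0 r : nat) (hm0 : (1 <= m0)%N)
    (hr : (1 <= r)%N) (B : 'I_m0.+1 -> 'M[R]_r) (j : 'I_m0) :
  (exists2 Q : 'M[R]_r,
      Q \in unitmx & B (regime_before j) *m Q = B (regime_after j))
  <->
  pseudo_factors B j =
    minn (effective_factors B (regime_before j))
         (effective_factors B (regime_after j)).
Proof.
rewrite /pseudo_factors /effective_factors.
(* Transposed, the concatenation becomes a vertical stack, whose row space is the sum of the two row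
   spaces. *)
rewrite -mxrank_tr tr_row_mx -addsmxE.
rewrite -(mxrank_tr (B (regime_before j))) -(mxrank_tr (B (regime_after j))).
apply: iff_trans (right_equiv_eqmx_tr _ _ _ _ _) _.
exact: iff_sym (rank_addsmx_eq_minn _ _ _ _ _ _).
Qed.
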